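(* Let $\mu$ be a Bernoulli measure on $X^{\mathbb N}$ defined by a positive probability vector $\boldsymbol{l}=(\boldsymbol{l}_x)_{x\in X}$. Suppose $g:X^{\mathbb N}\to X^{\mathbb N}$ is an invertible transformation generated by a strongly connected automaton $\mathcal A=(X,S,\pi,\lambda)$. Then the measures $\mu$ and $g_*\mu$ are singular unless $\boldsymbol{l}_{\lambda(s,x)}=\boldsymbol{l}_x$ for all $s\in S$ and $x\in X$, in which case $g_*\mu=\mu$.
   Context: $X$ is a finite set (alphabet) with more than one element, $X^{\mathbb N}$ the set of infinite sequences over $X$ with the product topology; $wX^{\mathbb N}$ is the set of sequences with prefix $w$. The Bernoulli measure defined by a probability vector $\boldsymbol{l}$ is the Borel probability measure with $\mu(x_1\ldots x_nX^{\mathbb N})=\boldsymbol{l}_{x_1}\cdots\boldsymbol{l}_{x_n}$. Pushforward: $g_*\mu(E)=\mu(g^{-1}(E))$. Two measures are singular if they are concentrated on disjoint Borel sets. An automaton $\mathcal A=(X,S,\pi,\lambda)$ consists of the alphabet $X$, a nonempty finite set $S$ of states, a transition function $\pi:S\times X\to S$ and an output function $\lambda:S\times X\to X$. Each state $s$ acts on $X^{\mathbb N}$ by $\omega_1\omega_2\ldots\mapsto\lambda(s_0,\omega_1)\lambda(s_1,\omega_2)\ldots$, where $s_0=s$ and $s_n=\pi(s_{n-1},\omega_n)$. A transformation $g$ is generated by $\mathcal A$ if it is the action of some (initial) state of $\mathcal A$, also denoted $g$. $\mathcal A$ is strongly connected if for any states $s,r\in S$ one can pass from $s$ to $r$ by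 successively applying transitions $s'\mapsto\pi(s',x)$, $x\in X$ (i.e. the directed graph on $S$ with edges $s'\to\pi(s',x)$ is strongly connected). *)

(* Defs.v *)
From HB Require Import structures.
From mathcomp Require Import all_boot all_order all_algebra.
From mathcomp Require Import all_classical all_reals all_analysis.

Set Implicit Arguments.
Unset Strict Implicit.
Unset Printing Implicit Defensive.

Import Order.TTheory GRing.Theory Num.Theory.
Local Open Scope classical_set_scope.
Local Open Scope ring_scope.

(* The library requires measurable types to be pointed; [hX] is a phantom
   argument that only serves to provide a (constant) point. *)
Definition seqspace (X : finType) (hX : (1 < #|X|)%N) : Type :=
  prod_topology (fun _ : nat => discrete_topology X).

HB.instance Definition _ (X : finType) (hX : (1 < #|X|)%N) :=
  Topological.on (seqspace hX).

HB.instance Definition _ (X : finType) (hX : (1 < #|X|)%N) :=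
  isPointed.Build (seqspace hX) (fun _ : nat => enum_val (Ordinal hX)).

Definition borel_seqspace (X : finType) (hX : (1 < #|X|)%N) :=
  g_sigma_algebraType (@open (seqspace hX)).

HB.instance Definition _ (X : finType) (hX : (1 < #|X|)%N) :=
  Measurable.on (borel_seqspace hX).

(* Sequences are indexed from 0: the letter [om n] is omega_(n+1). *)
Definition cylinder (X : finType) (w : seq X) : set (nat -> X) :=
  [set om | mkseq om (size w) = w].

Definition positive_probability_vector (R : realType) (X : finType)
    (l : X -> R) : Prop :=
  (forall x, 0 < l x) /\ \sum_x l x = 1.

Definition is_bernoulli (R : realType) (X : finType) (hX : (1 < #|X|)%N)
    (l : X -> R) (mu : probability (borel_seqspace hX) R) : Prop :=
  forall w : seq X, mu (cylinder w) = (\prod_(x <- w) l x)%:E.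

Definition mutually_singular (d : measure_display) (T : measurableType d)
    (R : realType) (mu nu : set T -> \bar R) : Prop :=
  exists A B : set T,
    [/\ measurable A, measurable B, A `&` B = set0,
        mu (~` A) = 0%E & nu (~` B) = 0%E].

Record automaton (X : finType) := Automaton {
  state : finType;
  state_nonempty : (0 < #|state|)%N;
  trans : state -> X -> state;
  out : state -> X -> X
}.

Fixpoint run (X : finType) (A : automaton X) (s : state A) (om : nat -> X)
    (n : nat) : state A :=
  if n is m.+1 then trans (run s om m) (om m) else s.

Definition action (X : finType) (A : automaton X) (s : state A)
    (om : nat -> X) : nat -> X :=
  fun n => out (run s om n) (om n).

Definition generated_by (X : finType) (A : automaton X)
    (g : (nat -> X) -> (nat -> X)) : Prop :=
  exists s : state A, g = action s.

Definition strongly_connected (X : finType) (A : automaton X) : Prop :=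
  forall s r : state A,
    connect [rel s1 s2 | [exists x : X, trans s1 x == s2]] s r.

(* Main.v *)
Require Import Defs.
From mathcomp Require Import all_boot all_order all_algebra.
From mathcomp Require Import all_classical all_reals all_analysis.
From mathcomp Require Import ring.
Import Order.TTheory GRing.Theory Num.Theory.
Local Open Scope classical_set_scope.
Local Open Scope ring_scope.

(** Write [nu] for the push-forward of [mu] by the action of the initial state
[s], and [l w] for the product of the weights of the letters of a word [w].

Since [g] is onto and every state is reachable from [s], every [out t] is a
permutation of the alphabet ([surjective_action_out],
[surjective_action_trans]).  Hence [s] permutes the words of each length [n],
and [nu] gives the cylinder of the word [s(w)] the mass [l w].  If all the
permutations [out t] preserve [l], then [l (s(w)) = l w], so [mu] and [nu]
agree on cylinders, hence on all Borel sets ([pushforward_preserved]).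

Otherwise, consider the Hellinger affinity of the two measures restricted to
words of length [n], that is the sum over [w] of the square root of
[l w * l (s(w))].  Reading the first letter gives a recursion over the states
([affinityE]) whose coefficients at a state [t] are the square roots of
[l x * l (out t x)].  By the inequality of arithmetic and geometric means they
add up to at most 1, and to less than 1 when [out t] does not preserve [l].
Strong connectivity lets every state reach such a state [t], so that after
some common number of steps all affinities drop by a factor [c < 1]
([affinity_contraction]); the affinity therefore tends to 0
([affinity_cvg0]).

A small affinity separates the two measures: the set of sequences whose prefix
of length [n] is at least as heavy for [nu] as for [mu] has [mu]-measure at
most the affinity, and so has its complement for [nu], because the minimum of
two nonnegative numbers is at most their geometric mean
([bernoulli_heavier_image], [pushforward_heavier_image]).  Choosing lengths
along which the affinities are summable, the Borel-Cantelli lemma makes the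
upper limit of these sets null for [mu] and its complement null for [nu]
([mutually_singular_summable]). *)

Set Implicit Arguments.
Unset Strict Implicit.
Unset Printing Implicit Defensive.

(** * Action of an automaton on finite words *)

Section Words.
Variables (X : finType) (A : automaton X).

Fixpoint word_action (s : state A) (w : seq X) : seq X :=
  if w is x :: w' then out s x :: word_action (trans s x) w' else [::].

Lemma mkseqS_head (T : Type) (f : nat -> T) n :
  mkseq f n.+1 = f 0%N :: mkseq (fun k => f k.+1) n.
Proof. by rewrite /mkseq /= (iotaDl 1) -map_comp. Qed.

(** This is what allows inductions that read words from the left, whereas [run]
unfolds from the right. *)
Lemma action_behead (s : state A) om :
  (fun k => action s om k.+1) =
  action (trans s (om 0%N)) (fun k => om k.+1).
Proof.
apply/funext => k; rewrite /action; congr (out _ _).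
by elim: k => //= k <-.
Qed.

Lemma mkseq_action (s : state A) om n :
  mkseq (action s om) n = word_action s (mkseq om n).
Proof.
elim: n s om => [|n IH] s om; first by [].
rewrite !mkseqS_head /= action_behead IH; reflexivity.
Qed.

(** Looking at the first letter of the images shows that [out s] is onto; on a
finite alphabet it is then injective. *)
Lemma surjective_action_out (s : state A) :
  (forall om', exists om, action s om = om') -> injective (out s).
Proof.
move=> sS; have /fin_all_exists[f fK] y : exists x, out s x = y.
  by have [om /(congr1 (@^~ 0%N))] := sS (fun=> y); exists (om 0%N).
by apply/bij_inj/bij_can_bij/fK; apply/injF_bij/(can_inj fK).
Qed.

(** Prefix the target by [out s x]: injectivity of [out s] forces the preimage to
start with [x], and its tail is sent by [trans s x] to the target. *)
Lemma surjective_action_trans (s : state A) x :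
  (forall om', exists om, action s om = om') ->
  forall om', exists om, action (trans s x) om = om'.
Proof.
move=> sS om'.
have [om om_eq] := sS (fun n => if n is k.+1 then om' k else out s x).
have om0 : om 0%N = x.
  by apply: (surjective_action_out sS); apply: (congr1 (@^~ 0%N) om_eq).
by exists (fun k => om k.+1); rewrite -om0 -action_behead om_eq.
Qed.

(** Induction along a path starting at [s]. *)
Lemma strongly_connected_ind (Q : state A -> Prop) (s : state A) :
    strongly_connected A ->
  Q s -> (forall t x, Q t -> Q (trans t x)) -> forall t, Q t.
Proof.
move=> hA Qs Qtrans t; have /connectP[p + ->] := hA s t.
elim: p s Qs => //= r p IH s Qs /andP[/existsP[x /eqP <-]].
exact: IH (Qtrans _ _ Qs).
Qed.

(** Induction along a path ending at [s], read backwards. *)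
Lemma strongly_connected_back_ind (Q : state A -> Prop) (s : state A) :
    strongly_connected A ->
  Q s -> (forall t x, Q (trans t x) -> Q t) -> forall t, Q t.
Proof.
move=> hA Qs Qtrans t; have /connectP[p + sE] := hA t s.
rewrite {s}sE in Qs *.
elim: p t Qs => //= r p IH t Qs /andP[/existsP[x /eqP tx] pr].
by apply: (Qtrans t x); rewrite tx; apply: IH pr.
Qed.

(** Turns sums over words into recursions on the length of the words. *)
Lemma sum_tuple_cons (V : nmodType) (n : nat) (F : seq X -> V) :
  \sum_(w : n.+1.-tuple X) F w = \sum_x \sum_(w : n.-tuple X) F (x :: w).
Proof.
rewrite pair_big /=.
rewrite (reindex (fun p : X * n.-tuple X => cons_tuple p.1 p.2)) //=.
exists (fun w => (thead w, behead_tuple w)) => [[x w] _|w _] /=.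
  by congr (_, _); apply/val_inj.
by apply/val_inj; rewrite /= [in RHS](tuple_eta w).
Qed.

Lemma sum_tuple0 (V : nmodType) (F : seq X -> V) :
  \sum_(w : 0.-tuple X) F w = F [::].
Proof.
by rewrite (bigD1 [tuple])//= big1 ?addr0// => w /eqP[]; apply: tuple0.
Qed.

Section Permutations.
Hypothesis out_inj : forall s : state A, injective (out s).

Lemma word_action_inj s : injective (word_action s).
Proof.
move=> w w'; elim: w s w' => [|x w IH] s [|x' w'] //= [].
by move=> /out_inj <- /IH ->.
Qed.

(** The automaton permutes the words of length [n]: first letters are permuted
by [out s], and given the first letter the tails are permuted by another
state. *)
Lemma sum_word_action (V : nmodType) n s (F : seq X -> V) :
  \sum_(w : n.-tuple X) F (word_action s w) = \sum_(w : n.-tuple X) F w.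
Proof.
elim: n s F => [|n IH] s F.
  by rewrite (sum_tuple0 (F \o word_action s)) sum_tuple0.
rewrite (sum_tuple_cons _ (F \o word_action s)) sum_tuple_cons /=.
rewrite [RHS](reindex_inj (@out_inj s)); apply: eq_bigr => x _.
by rewrite (IH _ (fun w => F (out s x :: w))).
Qed.

End Permutations.
End Words.

(** * Hellinger affinity of the two measures on words *)

Section Affinity.
Variables (R : realType) (X : finType) (l : X -> R) (A : automaton X).
Hypothesis hl : positive_probability_vector l.
Hypothesis out_inj : forall s : state A, injective (out s).

Definition weight (w : seq X) : R := \prod_(x <- w) l x.

(** The Hellinger affinity of the Bernoulli measure and of its image by the
state [s], both seen on words of length [n], in the form of a recursion over
the states; [affinityE] gives the usual formula. *)
Fixpoint affinity (n : nat) (s : state A) : R :=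
  if n is m.+1 then
    \sum_x Num.sqrt (l x) * Num.sqrt (l (out s x)) * affinity m (trans s x)
  else 1.

Lemma weight_ge0 w : 0 <= weight w.
Proof. by apply: prodr_ge0 => x _; apply/ltW/hl.1. Qed.

Lemma affinityE n s :
  affinity n s = \sum_(w : n.-tuple X)
    Num.sqrt (weight w) * Num.sqrt (weight (word_action s w)).
Proof.
elim: n s => [|n IH] s /=.
  rewrite (sum_tuple0 (fun w => Num.sqrt (weight w) *
    Num.sqrt (weight (word_action s w)))) /=.
  by rewrite /weight big_nil sqrtr1 mulr1.
rewrite (sum_tuple_cons _ (fun w => Num.sqrt (weight w) *
    Num.sqrt (weight (word_action s w)))) /=.
apply: eq_bigr => x _; rewrite IH mulr_sumr; apply: eq_bigr => w _.
rewrite /weight !big_cons !sqrtrM ?(ltW (hl.1 _))//.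
by rewrite mulrACA.
Qed.

(** The defect in the inequality of arithmetic and geometric means is half the
square of the difference of the roots; the means of [l x] and [l (out s x)]
add up to 1 because [out s] permutes the letters. *)
Lemma affinity1E s : affinity 1 s =
  1 - 2^-1 * \sum_x (Num.sqrt (l x) - Num.sqrt (l (out s x))) ^+ 2.
Proof.
have sqr x : Num.sqrt (l x) ^+ 2 = l x by rewrite sqr_sqrtr ?(ltW (hl.1 x)).
have out1 : \sum_x l (out s x) = 1.
  by rewrite -[RHS](hl.2) [RHS](reindex_inj (@out_inj s)).
have -> : \sum_x (Num.sqrt (l x) - Num.sqrt (l (out s x))) ^+ 2 =
    2 - 2 * affinity 1 s.
  transitivity (\sum_x l x + \sum_x l (out s x) - 2 * affinity 1 s).
    rewrite mulr_sumr -big_split -sumrB /=; apply: eq_bigr => x _.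
    by rewrite sqrrB !sqr; ring.
  by rewrite hl.2 out1.
by field.
Qed.

Lemma affinity1_le1 s : affinity 1 s <= 1.
Proof.
rewrite affinity1E gerBl mulr_ge0 ?invr_ge0//.
by apply: sumr_ge0 => x _; rewrite sqr_ge0.
Qed.

Lemma affinity1_lt1 s : (exists x, l (out s x) <> l x) -> affinity 1 s < 1.
Proof.
move=> [x lx]; rewrite affinity1E gtrBl mulr_gt0 ?invr_gt0//.
rewrite (bigD1 x)//= ltr_wpDr ?sumr_ge0// => [y _|]; first by rewrite sqr_ge0.
rewrite lt_def sqr_ge0 andbT sqrf_eq0 subr_eq0; apply/eqP => sqrt_eq; apply: lx.
by move/eqP: sqrt_eq; rewrite eqr_sqrt ?(ltW (hl.1 _))// => /eqP.
Qed.

(** The affinity of length [m + n] is a combination of affinities of length [n],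
whose coefficients add up to the affinity of length [m]. *)
Lemma affinity_add_le m n c s : (forall t, affinity n t <= c) ->
  affinity (m + n) s <= affinity m s * c.
Proof.
move=> affc; elim: m s => [|m IH] s /=; first by rewrite mul1r.
rewrite mulr_suml; apply: ler_sum => x _; rewrite -[leRHS]mulrA.
by rewrite ler_wpM2l// mulr_ge0 ?sqrtr_ge0.
Qed.

Lemma affinity_le1 n s : affinity n s <= 1.
Proof.
elim: n s => [//|n IH] s; have := affinity_add_le 1 s IH.
by rewrite mulr1 => /le_trans; apply; exact: affinity1_le1.
Qed.

Lemma affinity_nonincreasing m n s : (m <= n)%N -> affinity n s <= affinity m s.
Proof.
move=> /subnKC <-; rewrite -[leRHS]mulr1.
by apply: affinity_add_le => t; apply: affinity_le1.
Qed.

(** Strict positivity of [l] enters here: the letter [x] occurs in the recursion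
with a positive coefficient, so a gap below 1 at [trans s x] is felt at [s]. *)
Lemma affinity_step_lt1 n s x :
  affinity n (trans s x) < 1 -> affinity n.+1 s < 1.
Proof.
move=> lt1; apply: lt_le_trans (affinity1_le1 s) => /=.
rewrite (bigD1 x)//= [ltRHS](bigD1 x)//= ltr_leD//.
  by rewrite ltr_pM2l// mulr_gt0 ?sqrtr_gt0 ?hl.1.
by apply: ler_sum => y _; rewrite ler_wpM2l ?affinity_le1.
Qed.

(** Going backwards from a state where [l] is not preserved, every state has an
affinity below 1 for some length.  Affinities decrease with the length and
there are finitely many states, so one length and one bound serve them all. *)
Lemma affinity_contraction : strongly_connected A ->
  (exists (s : state A) x, l (out s x) <> l x) ->
  exists (N : nat) (c : R), [/\ 0 <= c, c < 1 & forall s, affinity N s <= c].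
Proof.
move=> hA [s0 x0].
have /fin_all_exists[n n_lt1] : forall s, exists n, affinity n s < 1.
  apply: (strongly_connected_back_ind (s := s0)) => //.
    by exists 1%N; apply: affinity1_lt1.
  by move=> t x [n lt1]; exists n.+1; exact: affinity_step_lt1 lt1.
pose N := (\max_(s : state A) n s)%N.
exists N, (\big[Num.max/0]_(s : state A) affinity N s); split.
- by apply: bigmax_ge_id.
- apply: bigmax_lt => // s _; apply: le_lt_trans (n_lt1 s).
  by apply: affinity_nonincreasing; apply: leq_bigmax.
- by move=> s; apply: le_bigmax.
Qed.

Lemma affinity_cvg0 s : strongly_connected A ->
  (exists (s : state A) x, l (out s x) <> l x) ->
  forall e, 0 < e -> exists n, affinity n s < e.
Proof.
move=> hA hne e e0; have [N [c [c0 c1 affc]]] := affinity_contraction hA hne.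
have aff_pow k t : affinity (k * N) t <= c ^+ k.
  elim: k t => [//|k IH] t; rewrite mulSnr exprSr.
  by rewrite (le_trans (affinity_add_le _ _ affc))// ler_wpM2r.
have : c ^+ k @[k --> \oo] --> 0 by apply: cvg_expr; rewrite ger0_norm.
move=> /cvgr0_norm_lt /(_ e e0) [k _ /(_ k (leqnn k))] /=.
by rewrite ger0_norm ?exprn_ge0// => ck; exists (k * N)%N; apply: le_lt_trans ck.
Qed.

End Affinity.

(** * Borel sets and sets depending on finitely many letters *)

Section Borel.
Variables (X : finType) (hX : (1 < #|X|)%N).

(** Sets that depend on finitely many letters.  Unlike cylinders, they are stable
under intersection and complement without exceptional cases. *)
Definition prefix_set (n : nat) (P : pred (seq X)) : set (borel_seqspace hX) :=
  [set om | P (mkseq om n)].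

Definition prefix_sets : set (set (borel_seqspace hX)) :=
  [set E | exists n P, E = prefix_set n P].

(** A cylinder constrains finitely many coordinates, each of them in a discrete
space. *)
Lemma nbhs_cylinder (om : seqspace hX) n : nbhs om (cylinder (mkseq om n)).
Proof.
rewrite /cylinder size_mkseq.
elim: n => [|n IH]; first exact: (filterS _ (@filterT _ (nbhs om) _)).
have near_n : \forall om' \near om, om' n = om n.
  exact: (@proj_continuous _ (fun=> discrete_topology X) n om _
    (discrete_set1 (om n : discrete_topology X))).
near=> om'; rewrite /= !mkseqS.
by congr rcons; [near: om' | near: om'].
Unshelve. all: by end_near. Qed.

(** Otherwise there are points outside [U] sharing arbitrarily long prefixes with
[om]; they converge to [om] coordinatewise, which contradicts [nbhs om U]. *)
Lemma cylinder_nbhs (om : seqspace hX) (U : set (seqspace hX)) :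
  nbhs om U -> exists n, cylinder (mkseq om n) `<=` U.
Proof.
move=> omU; apply/not_existsP => noncyl.
have /choice[f fP] n : exists om', cylinder (mkseq om n) om' /\ ~ U om'.
  by have /existsNP[om' /not_implyP] := noncyl n; exists om'.
have f_cvg : (f : nat -> seqspace hX) @ \oo --> om.
  apply/cvg_sup => i B [_ [[V _ <-] Vom] /filterS]; apply.
  exists i.+1 => // n /= lt_in; have [+ _] := fP n.
  rewrite /cylinder /= size_mkseq => /(congr1 (fun s => nth (om i) s i)).
  by rewrite !nth_mkseq// => ->.
have [n _ /(_ n (leqnn n))] := f_cvg _ omU.
exact: (fP n).2.
Qed.

Lemma measurable_prefix_set n P : measurable (prefix_set n P).
Proof.
apply: sub_sigma_algebra; rewrite openE => om Pom.
apply: filterS (nbhs_cylinder om n) => om'.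
by rewrite /cylinder /prefix_set /= size_mkseq => ->.
Qed.

Lemma prefix_setI m n P Q : prefix_set m P `&` prefix_set n Q =
  prefix_set (maxn m n) (fun w => P (take m w) && Q (take n w)).
Proof.
have take_mkseq (om : nat -> X) k N : (k <= N)%N ->
    take k (mkseq om N) = mkseq om k.
  by move=> kN; rewrite /mkseq -map_take take_iota (minn_idPl kN).
apply/seteqP; split=> om; rewrite /prefix_set /=
  !take_mkseq ?leq_maxl ?leq_maxr//; first by case=> -> ->.
by case/andP.
Qed.

(** An open set is the union over [n] of the sets of sequences whose cylinder of
length [n] it contains, and this union is countable. *)
Lemma measurable_prefix_sets :
  @measurable _ (borel_seqspace hX) = <<s prefix_sets >>.
Proof.
apply/seteqP; split; last first.
  apply: smallest_sub; first exact: sigma_algebra_measurable.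
  by move=> _ [n [P ->]]; apply: measurable_prefix_set.
apply: smallest_sub; first exact: smallest_sigma_algebra.
move=> U oU.
have -> : U = \bigcup_n prefix_set n (fun w => `[< cylinder w `<=` U >]).
  apply/seteqP; split=> om.
    rewrite openE in oU; move=> /oU /cylinder_nbhs[n cylU].
    by exists n => //; apply/asboolP.
  by move=> [n _ /asboolP]; apply; rewrite /cylinder /= size_mkseq.
apply: sigma_algebra_bigcup => n; apply: sub_sigma_algebra.
by exists n, (fun w => `[< cylinder w `<=` U >]).
Qed.

End Borel.

Arguments prefix_set {X} hX n P _.
Arguments prefix_sets {X} hX _.

(** * Bernoulli measures on sets depending on finitely many letters *)

Section Bernoulli.
Variables (R : realType) (X : finType) (hX : (1 < #|X|)%N) (l : X -> R).
Variable mu : probability (borel_seqspace hX) R.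
Hypothesis hmu : is_bernoulli l mu.

Lemma bernoulli_prefix_set n P : mu (prefix_set hX n P) =
  (\sum_(w : n.-tuple X) if P w then weight l w else 0)%:E.
Proof.
pose D := [set w : n.-tuple X | P w].
pose C (w : n.-tuple X) := prefix_set hX n (pred1 (w : seq X)).
have muC w : mu (C w) = (weight l w)%:E.
  rewrite -(hmu w); congr (mu _); apply/seteqP.
  by split=> om; rewrite /cylinder /C /prefix_set /= size_tuple => /eqP.
have -> : prefix_set hX n P = \bigcup_(w in D) C w.
  apply/seteqP; split=> om.
    by move=> Pom; exists (Tuple (introT eqP (size_mkseq om n))) => //; apply/eqP.
  by move=> [w Pw /eqP]; rewrite /prefix_set /= => ->.
have finD : finite_set D by apply: finite_finset.
rewrite measure_fin_bigcup//; last 2 first.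
- by move=> w w' _ _ [om [/eqP + /eqP]] => -> /val_inj.
- by move=> w _; apply: measurable_prefix_set.
transitivity (\sum_(w \in D) (weight l w)%:E)%E.
  by apply: eq_fsbigr => w _; exact: muC.
rewrite -(@bigfs _ _ _ _ (index_enum _) (fun w : n.-tuple X => P w)) ?index_enum_uniq//.
- by rewrite big_mkcond -sumEFin; apply: eq_bigr => w _; case: ifP.
- by move=> w _; rewrite mem_index_enum.
Qed.

End Bernoulli.

(** * A criterion for singularity *)

(** By the Borel-Cantelli lemma the upper limit of the [E k] is null for [mu] and
that of their complements is null for [nu]; the latter contains the complement
of the former. *)
Lemma mutually_singular_summable (d : measure_display) (T : measurableType d)
    (R : realType) (mu nu : {measure set T -> \bar R}) (E : (set T)^nat) :
    (forall k, measurable (E k)) ->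
    (\sum_(k <oo) mu (E k) < +oo)%E -> (\sum_(k <oo) nu (~` E k) < +oo)%E ->
  mutually_singular mu nu.
Proof.
move=> mE muE nuE; pose L := lim_sup_set E.
have mlim (F : (set T)^nat) : (forall k, measurable (F k)) ->
    measurable (lim_sup_set F).
  move=> mF; apply: bigcap_measurable => // n _.
  by apply: bigcup_measurable => k _; apply: mF.
have mEC k : measurable (~` E k) by apply: measurableC.
have mL : measurable L by apply: mlim.
exists (~` L), L; split=> //; first by apply: measurableC.
- by rewrite setICl.
- by rewrite setCK; apply: lim_sup_set_cvg0.
apply/eqP; rewrite eq_le measure_ge0 andbT -(lim_sup_set_cvg0 mEC nuE).
apply: le_measure; rewrite ?inE; [exact: measurableC|exact: mlim|].
move=> t; rewrite /L /lim_sup_set setC_bigcap => -[n _].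
rewrite setC_bigcup => nE m _; exists (maxn m n); first exact: leq_maxl.
by apply: nE; exact: leq_maxr.
Qed.

(** * Image of a Bernoulli measure *)

Section Pushforward.
Variables (R : realType) (X : finType) (hX : (1 < #|X|)%N) (l : X -> R).
Variable mu : probability (borel_seqspace hX) R.
Variables (A : automaton X) (s : state A).
Hypothesis hl : positive_probability_vector l.
Hypothesis hmu : is_bernoulli l mu.
Hypothesis out_inj : forall s : state A, injective (out s).

Let g : borel_seqspace hX -> borel_seqspace hX := action s.

Lemma preimage_prefix_set n P :
  g @^-1` prefix_set hX n P = prefix_set hX n (P \o word_action s).
Proof.
by apply/seteqP; split=> om; rewrite /prefix_set /= mkseq_action.
Qed.

Lemma measurable_action : measurable_fun setT g.
Proof.
apply: (measurability _ (measurable_prefix_sets hX)).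
move=> _ [_ [n [P ->]] <-]; rewrite setTI preimage_prefix_set.
exact: measurable_prefix_set.
Qed.

Lemma pushforward_prefix_set n P : pushforward mu g (prefix_set hX n P) =
  (\sum_(w : n.-tuple X) if P (word_action s w) then weight l w else 0)%:E.
Proof. by rewrite /pushforward preimage_prefix_set (bernoulli_prefix_set hmu). Qed.

Let nu : {measure set _ -> \bar R} :=
  measure_function_pushforward__canonical__measure_function_Measure mu measurable_action.

Lemma weight_word_action :
  (forall (t : state A) x, l (out t x) = l x) ->
  forall w, weight l (word_action s w) = weight l w.
Proof.
move=> lout w; rewrite /weight; elim: w s => [//|x w IH] t /=.
by rewrite !big_cons lout IH.
Qed.

(** Sets depending on finitely many letters generate the Borel sets and are stable
under intersection, so it suffices to compare the two measures on them, which
amounts to re-indexing a finite sum by the permutation of the words. *)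
Lemma pushforward_preserved :
  (forall (t : state A) x, l (out t x) = l x) ->
  forall E, measurable E -> pushforward mu g E = mu E.
Proof.
move=> lout E mE.
apply: (@measure_unique _ R _ (prefix_sets hX) (fun=> setT) _ _ _ _ nu mu) => //.
- exact: measurable_prefix_sets.
- move=> _ _ [m [P ->]] [n [Q ->]]; rewrite prefix_setI.
  by exists (maxn m n), (fun w => P (take m w) && Q (take n w)).
- by move=> _; exists 0%N, xpredT; apply/seteqP; split.
- by apply: bigcup_const; exists 0%N.
- move=> _ [n [P ->]]; rewrite [LHS]pushforward_prefix_set.
  apply: etrans (esym (bernoulli_prefix_set hmu n P)).
  rewrite -(sum_word_action out_inj _ s (fun w => if P w then weight l w else 0)).
  by congr EFin; apply: eq_bigr => w _; rewrite weight_word_action.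
- by move=> _; rewrite [ltLHS](@probability_setT _ _ _ mu) ltry.
Qed.

(** The words that are at least as heavy for the image measure as for the
Bernoulli measure: the cylinder of [word_action s w] has image measure
[weight l w]. *)
Definition heavier_image n : pred (seq X) := fun v =>
  [exists w : n.-tuple X, (word_action s w == v) && (weight l v <= weight l w)].

Lemma heavier_image_word_action n (w : n.-tuple X) :
  heavier_image n (word_action s w) =
  (weight l (word_action s w) <= weight l w).
Proof.
apply/existsP/idP => [[w' /andP[/eqP/(word_action_inj out_inj) -> //]]|le_w].
by exists w; rewrite eqxx.
Qed.

Lemma le_sqrt_mul (a b : R) : 0 <= a -> a <= b -> a <= Num.sqrt a * Num.sqrt b.
Proof.
move=> a0 ab; rewrite -[leLHS](sqr_sqrtr a0) expr2.
by rewrite ler_wpM2l ?sqrtr_ge0// ler_wsqrtr.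
Qed.

(** On these words [weight l v] is the smaller of the two masses, hence at most
their geometric mean. *)
Lemma bernoulli_heavier_image n :
  (mu (prefix_set hX n (heavier_image n)) <= (affinity l n s)%:E)%E.
Proof.
rewrite (bernoulli_prefix_set hmu) lee_fin (affinityE hl).
rewrite -(sum_word_action out_inj _ s
  (fun w => if heavier_image n w then weight l w else 0)).
apply: ler_sum => w _; rewrite heavier_image_word_action.
case: ifP => [le_w|_]; last by rewrite mulr_ge0 ?sqrtr_ge0.
by rewrite mulrC le_sqrt_mul ?(weight_ge0 hl).
Qed.

(** On the remaining words the mass for the image measure is the smaller one. *)
Lemma pushforward_heavier_image n :
  (pushforward mu g (~` prefix_set hX n (heavier_image n))
   <= (affinity l n s)%:E)%E.
Proof.
have -> : ~` prefix_set hX n (heavier_image n) =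
    prefix_set hX n (predC (heavier_image n)).
  by apply/seteqP; split=> om; rewrite /prefix_set /= => /negP.
rewrite pushforward_prefix_set lee_fin (affinityE hl).
apply: ler_sum => w _ /=; rewrite heavier_image_word_action -ltNge.
case: ifP => [/ltW le_w|_]; last by rewrite mulr_ge0 ?sqrtr_ge0.
by rewrite le_sqrt_mul ?(weight_ge0 hl).
Qed.

(** As the affinities tend to 0, lengths can be chosen along which they are
summable; the sets [heavier_image] of these lengths then separate the two
measures. *)
Lemma pushforward_singular : strongly_connected A ->
  (exists (t : state A) x, l (out t x) <> l x) ->
  mutually_singular mu (pushforward mu g).
Proof.
move=> hA hne.
have /choice[n n_lt] k : exists n, affinity l n s < 1 / (2 ^ k.+1)%:R.
  by apply: (affinity_cvg0 hl) => //; rewrite divr_gt0// ltr0n expn_gt0.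
have summable (u : nat -> \bar R) : (forall k, 0 <= u k)%E ->
    (forall k, u k <= (affinity l (n k) s)%:E)%E -> (\sum_(k <oo) u k < +oo)%E.
  move=> u0 u_le; apply: (@le_lt_trans _ _ 1%:E); last exact: ltry.
  apply: le_trans (epsilon_trick0 xpredT ler01).
  apply: lee_nneseries => k _ => [_|]; first exact: u0.
  by rewrite (le_trans (u_le k))// lee_fin ltW.
apply: (@mutually_singular_summable _ _ _ mu nu
  (fun k => prefix_set hX (n k) (heavier_image (n k)))).
- by move=> k; apply: measurable_prefix_set.
- by apply: summable => k //; apply: bernoulli_heavier_image.
- by apply: summable => k //; apply: pushforward_heavier_image.
Qed.

End Pushforward.

Theorem theorem7p5 (R : realType) (X : finType) (hX : (1 < #|X|)%N)
    (l : X -> R) (hl : positive_probability_vector l)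
    (mu : probability (borel_seqspace hX) R) (hmu : is_bernoulli l mu)
    (A : automaton X) (hA : strongly_connected A)
    (g : borel_seqspace hX -> borel_seqspace hX)
    (hg : bijective g) (hgA : generated_by A g) :
  (~ (forall (s : state A) (x : X), l (out s x) = l x) ->
     mutually_singular mu (pushforward mu g)) /\
  ((forall (s : state A) (x : X), l (out s x) = l x) ->
     forall E : set (borel_seqspace hX), measurable E ->
       pushforward mu g E = mu E).
Proof.
have [s gE] := hgA; rewrite {}gE in hg *.
have out_inj (t : state A) : injective (out t).
  apply: surjective_action_out; move: t.
  apply: (strongly_connected_ind (s := s)) => // [om'|t x].
    by have [h _ hK] := hg; exists (h om').
  exact: surjective_action_trans.
split=> [neq|]; last exact: pushforward_preserved.
apply: (pushforward_singular s hl hmu out_inj hA).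
by have /existsNP[t /existsNP[x neqtx]] := neq; exists t, x.
Qed.
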